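(* Let $n\ge 1$ and let $i\in\{0,1,\dots,n-1\}$. Let $R$ be the regular representation over $\mathbb C$ of the cyclic group $C_n$ of order $n$. Then, as formal power series in $s,t$, $$\sum_{p,m\ge 0}\dim\bigl((S^pR\otimes\wedge^mR)_{C_n,\chi_i}\bigr)s^pt^m=\frac1n\sum_{d\mid n}c_d(i)\frac{(1-(-t)^d)^{n/d}}{(1-s^d)^{n/d}}$$ $$=\frac1n\sum_{d\mid n}c_d(i)\Bigl(\sum_{a=0}^{n/d}(-1)^{(d+1)a}\binom{n/d}{a}t^{ad}\Bigr)\Bigl(\sum_{b\ge 0}\binom{(n/d)+b-1}{(n/d)-1}s^{bd}\Bigr).$$ Consequently, for all integers $p\ge 0$ and $0\le m\le n$, $$\dim\bigl((S^pR\otimes\wedge^mR)_{C_n,\chi_i}\bigr)=\frac{(-1)^m}{p+n}\sum_{d\mid n,\ d\mid p,\ d\mid m}(-1)^{m/d}c_d(i)\binom{(n+p)/d}{m/d,\ p/d,\ (n-m)/d}.$$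
   Context: $S^pR$ and $\wedge^mR$ denote the $p$-th symmetric and $m$-th exterior powers of $R$. Fix a generator $\gamma$ of $C_n$ and a primitive $n$-th root of unity $\zeta$; $\chi_i:C_n\to\mathbb C^\times$ is the linear character with $\chi_i(\gamma)=\zeta^i$. For a $C_n$-module $W$, $W_{C_n,\chi_i}$ is the isotypic component $\{w\in W: g\cdot w=\chi_i(g)w \text{ for all } g\in C_n\}$. The Ramanujan sum $c_d(i)$ is the sum of the $i$-th powers of all primitive $d$-th roots of unity in $\mathbb C$. The multinomial coefficient is $\binom{a+b+c}{a,\,b,\,c}=\frac{(a+b+c)!}{a!\,b!\,c!}$. Every positive integer divides $0$. *)

(* Defs.v *)
From HB Require Import structures.
From mathcomp Require Import all_boot all_order all_algebra all_fingroup.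
From mathcomp Require Import cyclic mxrepresentation character.
From mathcomp Require Import mathcomp_extra boolp classical_sets cardinality fsbigop reals.
From mathcomp Require Import complex.
Set Implicit Arguments.
Unset Strict Implicit.
Unset Printing Implicit Defensive.

Import Order.TTheory GRing.Theory Num.Theory.
Local Open Scope ring_scope.

Record fps (R : Type) := Fps { fps_coef :> nat -> R }.

HB.instance Definition _ (R : Type) := gen_eqMixin (fps R).
HB.instance Definition _ (R : Type) := gen_choiceMixin (fps R).

Lemma fpsP (R : Type) (f g : fps R) : (forall k, f k = g k) <-> f = g.
Proof.
split=> [|-> //]; case: f g => f [g] /= fg.
by congr Fps; apply/funext.
Qed.

Section FpsRing.
Variable R : comNzRingType.
Implicit Types f g h : fps R.

Definition fps_zero : fps R := Fps (fun=> 0).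
Definition fps_opp f : fps R := Fps (fun k => - f k).
Definition fps_add f g : fps R := Fps (fun k => f k + g k).
Definition fpsC (c : R) : fps R := Fps (fun k => if k == 0%N then c else 0).
Definition fps_mul f g : fps R :=
  Fps (fun k => \sum_(j < k.+1) f j * g (k - j)%N).

Fact fps_addA : associative fps_add.
Proof. by move=> f g h; apply/fpsP => k /=; rewrite addrA. Qed.
Fact fps_addC : commutative fps_add.
Proof. by move=> f g; apply/fpsP => k /=; rewrite addrC. Qed.
Fact fps_add0 : left_id fps_zero fps_add.
Proof. by move=> f; apply/fpsP => k /=; rewrite add0r. Qed.
Fact fps_addN : left_inverse fps_zero fps_opp fps_add.
Proof. by move=> f; apply/fpsP => k /=; rewrite addNr. Qed.

HB.instance Definition _ :=
  GRing.isZmodule.Build (fps R) fps_addA fps_addC fps_add0 fps_addN.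

Definition fps_trunc (n : nat) f : {poly R} := \poly_(i < n.+1) f i.

Fact fps_mulE n k f g : (k <= n)%N ->
  (fps_mul f g) k = (fps_trunc n f * fps_trunc n g)`_k.
Proof.
move=> kn; rewrite coefM; apply: eq_bigr => j _.
rewrite !coef_poly !ltnS (leq_trans (leq_subr _ _) kn).
by rewrite (leq_trans _ kn) // -ltnS.
Qed.

Fact fps_mulC : commutative fps_mul.
Proof. by move=> f g; apply/fpsP => k; rewrite !(@fps_mulE k) // mulrC. Qed.

Fact fps_mulA : associative fps_mul.
Proof.
move=> f g h; apply/fpsP => k.
transitivity ((fps_trunc k f * (fps_trunc k g * fps_trunc k h))`_k).
  rewrite coefM; apply: eq_bigr => j _.
  by rewrite (@fps_mulE k) ?leq_subr // coef_poly ltn_ord.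
rewrite mulrA coefM; apply: eq_bigr => j _.
by rewrite (@fps_mulE k) 1?coef_poly 1?ltnS ?leq_subr // -ltnS.
Qed.

Fact fps_mul1 : left_id (fpsC 1) fps_mul.
Proof.
move=> f; apply/fpsP => k /=; rewrite big_ord_recl /= mul1r subn0.
by rewrite big1 ?addr0 // => j _; rewrite mul0r.
Qed.

Fact fps_mulDl : left_distributive fps_mul fps_add.
Proof.
move=> f g h; apply/fpsP => k /=; rewrite -big_split /=.
by apply: eq_bigr => j _; rewrite mulrDl.
Qed.

Fact fps_1neq0 : fpsC 1 != 0.
Proof. by apply/eqP => /fpsP/(_ 0%N)/eqP; rewrite /= oner_eq0. Qed.

HB.instance Definition _ := GRing.Zmodule_isComNzRing.Build (fps R)
  fps_mulA fps_mulC fps_mul1 fps_mulDl fps_1neq0.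

Definition fps_unit : pred (fps R) := fun f => `[< exists g, g * f = 1 >].
Definition fps_inv f : fps R :=
  if pselect (exists g, g * f = 1) is left e then projT1 (cid e) else f.

Fact fps_mulVr : {in fps_unit, left_inverse 1 fps_inv *%R}.
Proof.
move=> f /asboolP e; rewrite /fps_inv; case: pselect => // e'.
exact: (projT2 (cid e')).
Qed.
Fact fps_unitP f g : g * f = 1 -> fps_unit f.
Proof. by move=> gf; apply/asboolP; exists g. Qed.
Fact fps_inv_out : {in [predC fps_unit], fps_inv =1 id}.
Proof.
move=> f /negP nf; rewrite /fps_inv; case: pselect => // e.
by case: nf; apply/asboolP.
Qed.

HB.instance Definition _ :=
  GRing.ComNzRing_hasMulInverse.Build (fps R) fps_mulVr fps_unitP fps_inv_out.

Definition fpsX : fps R := Fps (fun k => (k == 1%N)%:R).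

(** The sum of the family [F] is meaningful only when [F b] has order at least
    [b]: the coefficient of degree [k] then only involves [F 0], ..., [F k]. *)
Definition fps_sum (F : nat -> fps R) : fps R :=
  Fps (fun k => \sum_(b < k.+1) (F b) k).

Lemma fps_coefD f g k : (f + g) k = f k + g k.
Proof. by []. Qed.

Lemma fps_coefM f g k : (f * g) k = \sum_(j < k.+1) f j * g (k - j)%N.
Proof. by []. Qed.

Lemma fps_coef_sum (I : Type) (r : seq I) (P : pred I) (F : I -> fps R) k :
  (\sum_(i <- r | P i) F i) k = \sum_(i <- r | P i) (F i) k.
Proof. by apply: (big_morph (fun f : fps R => f k)). Qed.

Lemma fps_sumE (F : nat -> fps R) (n k : nat) :
    (forall b j, (j < b)%N -> (F b) j = 0) -> (k < n)%N ->
  (\sum_(b < n) F b) k = (fps_sum F) k.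
Proof.
move=> F0 kn; rewrite fps_coef_sum /= -!(big_mkord xpredT (fun b => (F b) k)).
rewrite (big_cat_nat (leq0n k.+1) kn) /= [X in _ + X](_ : _ = 0) ?addr0 //.
rewrite big_nat_cond big1 // => b.
by rewrite andbT => /andP[kb _]; apply: F0.
Qed.

Lemma fps_coefXM f k : (fpsX * f) k = if k is k'.+1 then f k' else 0.
Proof.
rewrite fps_coefM; case: k => [|k]; first by rewrite big_ord1 /= mul0r.
rewrite big_ord_recl /= mul0r add0r big_ord_recl /= mul1r subSS subn0.
by rewrite big1 ?addr0 // => j _; rewrite mul0r.
Qed.

Lemma fps_coefXn d k : (fpsX ^+ d) k = (k == d)%:R.
Proof.
elim: d k => [|d IHd] k; first by rewrite expr0 /=; case: eqP.
by rewrite exprS fps_coefXM; case: k => [|k]; rewrite ?IHd.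
Qed.

End FpsRing.

Section FpsUnit.
Variable R : comUnitRingType.

Lemma fps_unitE (f : fps R) :
  (f \is a GRing.unit) = (f 0%N \is a GRing.unit).
Proof.
apply/idP/idP => [Uf|Uf0].
  have /fpsP/(_ 0%N) := mulVr Uf.
  rewrite fps_coefM big_ord1 /= => e.
  by apply/unitrP; exists (f^-1 0%N); rewrite e mulrC e.
pose step (s : seq R) :=
  rcons s ((f 0%N)^-1 *
    ((size s == 0%N)%:R - \sum_(j < size s) s`_j * f (size s - j)%N)).
pose S k := iter k step [::].
have sz k : size (S k) = k by elim: k => //= k IHk; rewrite size_rcons IHk.
have nthS k j : (j < k)%N -> (S k)`_j = (S j.+1)`_j.
  elim: k => // k IHk; rewrite ltnS leq_eqVlt => /predU1P[-> //|jk].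
  by rewrite /= nth_rcons -/(S k) sz jk IHk.
apply/unitrP; exists (Fps (fun k => (S k.+1)`_k)).
suff e : Fps (fun k => (S k.+1)`_k) * f = 1 by split; rewrite // mulrC.
apply/fpsP => k; rewrite fps_coefM big_ord_recr /= subnn.
rewrite nth_rcons -/(S k) sz ltnn eqxx mulrAC mulVr // mul1r addrC.
under [X in _ + X]eq_bigr => j _ do rewrite -/(S j.+1) -(nthS k j) //.
by rewrite subrK; case: eqP.
Qed.

End FpsUnit.

(** R[[s, t]] is encoded as R[[t]][[s]]. *)
Notation "{ 'fps2' R }" := (fps (fps R)) (at level 0, format "{ 'fps2'  R }").

Section Fps2.
Variable R : comNzRingType.

Definition fps2_cst (c : R) : {fps2 R} := fpsC (fpsC c).
Definition fps2_s : {fps2 R} := fpsX (fps R).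
Definition fps2_t : {fps2 R} := fpsC (fpsX R).

(** [fps2_gf a] is the series with [a p m] as coefficient of s^p t^m. *)
Definition fps2_gf (a : nat -> nat -> R) : {fps2 R} :=
  Fps (fun p => Fps (fun m => a p m)).

Lemma fps2_monomialE c p m p' m' :
  (fps2_cst c * fps2_s ^+ p * fps2_t ^+ m) p' m'
    = if (p' == p) && (m' == m) then c else 0.
Proof.
have CM (S : comNzRingType) (a : S) (f : fps S) k : (fpsC a * f) k = a * f k.
  rewrite fps_coefM big_ord_recl subn0 big1 ?addr0 // => j _.
  by rewrite /= mul0r.
have tE : fps2_t ^+ m = fpsC (fpsX R ^+ m).
  elim: m => // m IHm; rewrite !exprS IHm; apply/fpsP => k.
  by rewrite CM /=; case: eqP; rewrite ?mulr0.
rewrite -mulrA CM tE [_ * fpsC _]mulrC CM CM fps_coefXn [_ * (_ == p)%:R]mulrC.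
case: (p' == p); rewrite ?mul1r ?mul0r ?mulr0 //= fps_coefXn.
by case: (m' == m); rewrite ?mulr1 ?mulr0.
Qed.

End Fps2.

Section MxSpan.
Variables (F : fieldType) (N : nat).
Implicit Types (S : set 'rV[F]_N) (W : 'M[F]_N).

Definition is_mxspan S W :=
  (forall v, S v -> (v <= W)%MS) /\
  (forall W', (forall v, S v -> (v <= W')%MS) -> (W <= W')%MS).

Lemma mxspan_ex S : exists W, is_mxspan S W.
Proof.
pose good W := forall W', (forall v, S v -> (v <= W')%MS) -> (W <= W')%MS.
suff H k W : good W -> (N - \rank W <= k)%N -> exists W, is_mxspan S W.
  by apply: (H N 0); [move=> W' _; apply: sub0mx | rewrite leq_subr].
elim: k W => [|k IHk] W gW kW.
  exists W; split=> // v _; apply: submx_full.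
  by rewrite /row_full eqn_leq rank_leq_col -subn_eq0 -leqn0.
have [SW|] := pselect (forall v, S v -> (v <= W)%MS); first by exists W.
move=> /existsNP[v /not_implyP[Sv /negP vW]].
apply: (IHk (W + v)%MS) => [W' SW'|]; first by rewrite addsmx_sub gW // SW'.
have : (W < W + v)%MS.
  rewrite ltmxE addsmxSl /=; apply: contra vW; apply: submx_trans.
  exact: addsmxSr.
move=> /rank_ltmx/[dup] ltW /leq_trans/(_ (rank_leq_row _)) WN.
by rewrite -ltnS; apply: leq_trans kW; rewrite ltn_sub2l // (leq_trans ltW).
Qed.

Definition mxspan S : 'M[F]_N := projT1 (cid (mxspan_ex S)).

Lemma mxspanP S : is_mxspan S (mxspan S).
Proof. exact: (projT2 (cid (mxspan_ex S))). Qed.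

Lemma mxspan_mxmodule (gT : finGroupType) (G : {group gT})
    (rG : mx_representation F G N) S :
  (forall g v, g \in G -> S v -> S (v *m rG g)) -> mxmodule rG (mxspan S).
Proof.
move=> GS; have [SW minW] := mxspanP S; apply/mxmoduleP => g Gg.
suff : (mxspan S <= mxspan S *m rG g^-1%g)%MS.
  by move=> /(submxMr (rG g)); rewrite repr_mxKV.
apply: minW => v Sv; rewrite -[v](repr_mxK rG Gg).
by apply: submxMr; apply: SW; apply: GS.
Qed.

End MxSpan.

(** MathComp modules are spaces of row vectors, g acting on v as
    [v *m rG g].  The tensor power T^k(F^d) is the space of row vectors whose
    coordinates are indexed by the maps from k to d, i.e. by the words
    e_(f 0) (x) ... (x) e_(f (k - 1)) in the standard basis of F^d. *)
Section Powers.
Variables (F : fieldType) (gT : finGroupType) (G : {group gT}) (d : nat).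
Variables (rG : mx_representation F G d) (k : nat).

Definition tpow_dim := #|{ffun 'I_k -> 'I_d}|.

Definition pure_tensor (v : 'I_k -> 'rV[F]_d) : 'rV[F]_tpow_dim :=
  \row_a \prod_j v j 0 ((enum_val a : {ffun 'I_k -> 'I_d}) j).

Definition tpow_mx (A : 'M[F]_d) : 'M[F]_tpow_dim :=
  \matrix_(a, b) \prod_j A ((enum_val a : {ffun 'I_k -> 'I_d}) j)
                           ((enum_val b : {ffun 'I_k -> 'I_d}) j).

Lemma pure_tensorM v A :
  pure_tensor v *m tpow_mx A = pure_tensor (fun j => v j *m A).
Proof.
apply/rowP => b; rewrite !mxE.
under [RHS]eq_bigr do rewrite mxE.
rewrite bigA_distr_bigA.
rewrite [RHS](reindex (@enum_val _ {ffun 'I_k -> 'I_d})) /=; last first.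
  by apply: onW_bij; apply: enum_val_bij.
by apply: eq_bigr => a _; rewrite !mxE -big_split.
Qed.

Lemma tpow_mxM A B : tpow_mx (A *m B) = tpow_mx A *m tpow_mx B.
Proof.
apply/matrixP => a b; rewrite !mxE.
under [LHS]eq_bigr do rewrite mxE.
rewrite bigA_distr_bigA.
rewrite [LHS](reindex (@enum_val _ {ffun 'I_k -> 'I_d})) /=; last first.
  by apply: onW_bij; apply: enum_val_bij.
by apply: eq_bigr => c _; rewrite !mxE -big_split.
Qed.

Lemma tpow_mx1 : tpow_mx 1%:M = 1%:M.
Proof.
apply/matrixP => a b; rewrite !mxE -(inj_eq enum_val_inj).
have [->|] := eqVneq (enum_val a) (enum_val b).
  by rewrite big1 // => j _; rewrite mxE eqxx.
move=> /eqP/ffunP/existsNP[j /eqP ab].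
by rewrite (bigD1 j) //= mxE (negPf ab) mul0r.
Qed.

Fact tpow_repr_proof : mx_repr G (fun g => tpow_mx (rG g)).
Proof.
by split=> [|x y Gx Gy]; rewrite ?repr_mx1 ?tpow_mx1 // repr_mxM ?tpow_mxM.
Qed.
Definition tpow_repr := MxRepresentation tpow_repr_proof.

Definition sym_rel : set 'rV[F]_tpow_dim :=
  [set x | exists (v : 'I_k -> 'rV[F]_d) (s : 'S_k),
     x = pure_tensor v - pure_tensor (v \o s)].

Definition ext_rel : set 'rV[F]_tpow_dim :=
  [set x | exists (v : 'I_k -> 'rV[F]_d) (j1 j2 : 'I_k),
     [/\ j1 != j2, v j1 = v j2 & x = pure_tensor v]].

Fact sym_rel_module : mxmodule tpow_repr (mxspan sym_rel).
Proof.
apply: mxspan_mxmodule => g _ _ [v [s ->]].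
by exists (fun j => v j *m rG g), s; rewrite mulmxBl /= !pure_tensorM.
Qed.

Fact ext_rel_module : mxmodule tpow_repr (mxspan ext_rel).
Proof.
apply: mxspan_mxmodule => g _ _ [v [j1 [j2 [j12 vj ->]]]].
exists (fun j => v j *m rG g), j1, j2.
by split; rewrite ?vj //= pure_tensorM.
Qed.

Definition sym_repr := factmod_repr sym_rel_module.
Definition ext_repr := factmod_repr ext_rel_module.

End Powers.

Section Isotypic.
Variables (F : fieldType) (gT : finGroupType) (G : {group gT}).

(** A matrix whose row space is {w | g.w = chi(g) w for all g in G}. *)
Definition isotypic d (rG : mx_representation F G d) (chi : gT -> F) : 'M_d :=
  (\bigcap_(g in G) eigenspace (rG g) (chi g))%MS.

Lemma isotypicP d (rG : mx_representation F G d) chi (w : 'rV_d) :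
  reflect (forall g, g \in G -> w *m rG g = chi g *: w)
          (w <= isotypic rG chi)%MS.
Proof.
by apply: (iffP sub_bigcapmxP) => H g Gg; apply/eigenspaceP; apply: H.
Qed.

(** Value at [g] of the character of <[gam]> sending [gam] to [zeta ^+ i]; the
    index is the discrete logarithm of [g] in base [gam]. *)
Definition cyc_char (gam : gT) (zeta : F) (i : nat) (g : gT) : F :=
  zeta ^+ (i * index g [seq (gam ^+ k)%g | k <- iota 0 #[gam]%g]).

Lemma cyc_charX gam zeta i k : zeta ^+ #[gam]%g = 1 ->
  cyc_char gam zeta i (gam ^+ k)%g = zeta ^+ (i * k).
Proof.
move=> z1; rewrite /cyc_char -expg_mod_order.
set l := (k %% _)%N; have ll : (l < #[gam]%g)%N by rewrite ltn_mod order_gt0.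
set s := map _ _; have ss : size s = #[gam]%g by rewrite size_map size_iota.
have -> : (gam ^+ l)%g = nth 1%g s l.
  by rewrite (nth_map 0%N) ?size_iota // nth_iota.
rewrite index_uniq ?ss //; last first.
  rewrite map_inj_in_uniq ?iota_uniq // => a b.
  rewrite !mem_iota !add0n => /andP[_ la] /andP[_ lb] /eqP.
  by rewrite eq_expg_mod_order !modn_small // => /eqP.
rewrite [in RHS](divn_eq k #[gam]%g) -/l mulnDr exprD mulnA.
by rewrite [zeta ^+ (_ * #[_]%g)]exprM exprAC z1 expr1n mul1r.
Qed.

Lemma cyc_charM gam zeta i : zeta ^+ #[gam]%g = 1 ->
  {in <[gam]>%g &, {morph cyc_char gam zeta i : x y / (x * y)%g >-> x * y}}.
Proof.
move=> z1 _ _ /cycleP[a ->] /cycleP[b ->].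
by rewrite -expgD !cyc_charX // mulnDr exprD.
Qed.

End Isotypic.

(** A finite-support sum; the index set is finite, being made of roots of
    X^d - 1 (and empty for d = 0). *)
Definition ramanujan_sum (F : fieldType) (d i : nat) : F :=
  \sum_(z \in [set z : F | d.-primitive_root z]%classic) z ^+ i.

Definition multinomial3 (a b c : nat) : nat :=
  (a + b + c)`! %/ (a`! * b`! * c`!).

Definition sym_ext_repr (F : fieldType) (gT : finGroupType) (G : {group gT})
    (d : nat) (rG : mx_representation F G d) (p m : nat) :=
  prod_repr (sym_repr rG p) (ext_repr rG m).

(* Main.v *)
From HB Require Import structures.
Require Import Defs.
From mathcomp Require Import all_boot all_order all_algebra all_fingroup.
From mathcomp Require Import cyclic mxrepresentation character ring.
From mathcomp Require Import boolp classical_sets fsbigop reals complex.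
Set Implicit Arguments.
Unset Strict Implicit.
Unset Printing Implicit Defensive.
Import GRing.Theory.
Local Open Scope ring_scope.

(** The dimension of an isotypic component is the trace of the projection
    |G|^-1 \sum_g chi(g)^-1 rho(g).  The Fourier matrix diagonalises R, gamma^k
    having the eigenvalues w^x (x < n) for w = zeta^k; hence gamma^k has trace
    h_p(w^0, ..., w^(n-1)) on S^pR and e_m(w^0, ..., w^(n-1)) on /\^mR.
    Summing over p and m gives \prod_x (1 + w^x t) / (1 - w^x s), which is
    ((1 - (-t)^d) / (1 - s^d))^(n/d) when w has order d, because
    \prod_(x < d) (1 - w^x X) = 1 - X^d.  Grouping the k by the order of zeta^k
    turns the sum of the zeta^(-ik) into Ramanujan sums. *)

(** * Dimensions of isotypic components *)

(** In the rank factorisation [e = C B], [C] cancels on the left and [B] on the right, so [e e = e]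
    forces [B C = 1]; and [C B] has the trace of [B C]. *)
Lemma mxtrace_idempotent (F : fieldType) (N : nat) (e : 'M[F]_N) :
  e *m e = e -> \tr e = (\rank e)%:R.
Proof.
move=> ee.
have: col_base e *m row_base e = e := mulmx_base e.
have: row_full (col_base e) := col_base_full e.
have: row_free (row_base e) := row_base_free e.
move: (col_base e) (row_base e) => C B Bfree /row_fullP[L LC] CB.
rewrite -[in LHS]CB mxtrace_mulC -(mxtrace1 F (\rank e)); congr (\tr _).
apply: (row_free_inj Bfree); rewrite mul1mx.
have : L *m (C *m B *m (C *m B)) = L *m (C *m B) by rewrite !CB ee.
by rewrite !mulmxA LC !mul1mx.
Qed.

Section IsotypicRank.
Variables (F : fieldType) (gT : finGroupType) (G : {group gT}).

(** The averaging operator [e] fixes every isotypic vector and has isotypic rows, so it is an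
    idempotent whose row space is the component. *)
Lemma rank_isotypic N (rG : mx_representation F G N) (chi : gT -> F) :
    #|G|%:R != 0 :> F -> {in G, forall g, chi g != 0} ->
    {in G &, {morph chi : x y / (x * y)%g >-> x * y}} ->
  (\rank (isotypic rG chi))%:R
    = #|G|%:R^-1 * \sum_(g in G) (chi g)^-1 * \tr (rG g).
Proof.
move=> nG0 chi0 chiM.
pose e := #|G|%:R^-1 *: \sum_(g in G) (chi g)^-1 *: rG g.
have we m (w : 'M_(m, N)) :
    (forall g, g \in G -> w *m rG g = chi g *: w) -> w *m e = w.
  move=> wP; rewrite /e -scalemxAr mulmx_sumr.
  under eq_bigr => g Gg do
    rewrite -scalemxAr wP // scalerA mulVf ?chi0 // scale1r.
  by rewrite sumr_const -scaler_nat scalerA mulVf // scale1r.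
have eP g : g \in G -> e *m rG g = chi g *: e.
  move=> Gg; rewrite /e -scalemxAl mulmx_suml scalerA mulrC -scalerA.
  congr (_ *: _); rewrite [RHS]scaler_sumr.
  rewrite [RHS](reindex_inj (mulIg g)) /=.
  apply: eq_big => [h|h Gh]; first by rewrite groupMr.
  by rewrite repr_mxM // scalerA -scalemxAl chiM // invfM mulrC mulfVK ?chi0.
have iso_e : (isotypic rG chi :=: e)%MS.
  apply/eqmxP/andP; split; apply/row_subP => j.
    have /isotypicP/we <- : (row j (isotypic rG chi) <= isotypic rG chi)%MS.
      exact: row_sub.
    exact: submxMl.
  by apply/isotypicP => g Gg; rewrite -row_mul eP // linearZ.
rewrite iso_e -mxtrace_idempotent ?we //.
rewrite linearZ /= raddf_sum /=; congr (_ * _).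
by apply: eq_bigr => g _; rewrite linearZ.
Qed.

(* The columns of [Q] are functionals on the quotient by [U], the rows of [S]
   lift a basis: [1 - Q S] having its rows in [U] makes the classes of [S] and
   the functionals [Q] inverse to each other. *)
Lemma factmod_trace N M (rT : mx_representation F G N) (U : 'M_N)
    (Umod : mxmodule rT U) (Q : 'M_(N, M)) (S : 'M_(M, N)) g :
    U *m Q = 0 -> (1%:M - Q *m S <= U)%MS -> g \in G ->
  \tr (factmod_repr Umod g) = \tr (S *m rT g *m Q).
Proof.
move=> UQ QSU Gg.
have QS1 : Q *m in_factmod U S = in_factmod U 1%:M.
  apply/esym/eqP; rewrite -subr_eq0 /in_factmod /= mulmxA -mulmxBl.
  by rewrite -[_ *m col_base _]/(in_factmod U _) in_factmod_eq0.
have valQ m (W : 'M_(m, N)) : val_factmod (in_factmod U W) *m Q = W *m Q.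
  apply/eqP; rewrite -subr_eq0 -mulmxBl.
  have /submxP[D ->] : (val_factmod (in_factmod U W) - W <= U)%MS.
    by rewrite -in_factmod_eq0 linearB /= val_factmodK subrr.
  by rewrite -mulmxA UQ mulmx0.
have VQI : val_factmod 1%:M *m Q *m in_factmod U S = 1%:M.
  by rewrite -mulmxA QS1 -in_factmodE val_factmodK.
have ISg : in_factmod U S *m factmod_mx Umod g = in_factmod U (S *m rT g).
  by rewrite in_factmodJ.
rewrite -(valQ _ (S *m rT g)) -ISg [val_factmod (_ *m _)]val_factmodE.
move: (val_factmod 1%:M) (in_factmod U S) VQI => V I VQI.
(* Insert [V Q I = 1], then use the cyclicity of the trace. *)
by rewrite /= -[X in \tr X = _]mulmx1 -VQI !mulmxA mxtrace_mulC !mulmxA.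
Qed.

End IsotypicRank.

(** * Tensor and symmetric powers *)

(** The vectors that [A] sends into [W] form a kernel, hence a subspace; it contains [S], so it
    contains the span. *)
Lemma mxspan_mulmx_sub (F : fieldType) N M m (S : set 'rV[F]_N)
    (A : 'M_(N, M)) (W : 'M_(m, M)) :
  (forall v, S v -> (v *m A <= W)%MS) -> (mxspan S *m A <= W)%MS.
Proof.
move=> SA; have [_ minS] := mxspanP S.
have /sub_kermxP : (mxspan S <= kermx (A *m cokermx W))%MS.
  apply: minS => v /SA; rewrite submxE => /eqP vA.
  by apply/sub_kermxP; rewrite mulmxA.
by rewrite submxE mulmxA => ->.
Qed.

Section TensorPower.
Variables (F : fieldType) (d k : nat).
Implicit Types (v : 'I_k -> 'rV[F]_d) (f : {ffun 'I_k -> 'I_d}).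

Lemma pure_tensor_mul M (Q : 'M[F]_(tpow_dim d k, M)) v l :
  (pure_tensor v *m Q) 0 l
    = \sum_(f : {ffun 'I_k -> 'I_d}) \prod_j v j 0 (f j) * Q (enum_rank f) l.
Proof.
rewrite !mxE (reindex (@enum_rank {ffun 'I_k -> 'I_d})) /=; last first.
  by apply: onW_bij; apply: enum_rank_bij.
by apply: eq_bigr => f _; rewrite !mxE enum_rankK.
Qed.

Lemma pure_tensor_delta f :
  pure_tensor (fun j => 'e_(f j)) = 'e_(enum_rank f) :> 'rV[F]_(tpow_dim d k).
Proof.
apply/rowP => a; rewrite !mxE eqxx /= -(inj_eq enum_val_inj) enum_rankK.
have [->|] := eqVneq (enum_val a) f.
  by rewrite big1 // => j _; rewrite !mxE !eqxx.
move=> /eqP/ffunP/existsNP[j /eqP af].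
by rewrite (bigD1 j) //= !mxE (negPf af) andbF mul0r.
Qed.

Lemma tpow_mx_diag (D : 'rV[F]_d) :
  tpow_mx k (diag_mx D) = diag_mx (pure_tensor (fun=> D)).
Proof.
apply/matrixP => a b; rewrite !mxE -(inj_eq enum_val_inj).
have [->|] := eqVneq (enum_val a) (enum_val b).
  by apply: eq_bigr => j _; rewrite !mxE eqxx mulr1n.
move=> /eqP/ffunP/existsNP[j /eqP ab].
by rewrite (bigD1 j) //= !mxE (negPf ab) mulr0n mul0r.
Qed.

Variables (gT : finGroupType) (G : {group gT}).
Variable rG : mx_representation F G d.
Variable S : set 'rV[F]_(tpow_dim d k).
Hypothesis Smod : mxmodule (tpow_repr rG k) (mxspan S).
Hypothesis S_tpow : forall u A, S u -> S (u *m tpow_mx k A).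

(** Common to S^k and the exterior power: the classes of the words [r l] span the quotient and [Q]
    gives coordinates on them. As the relations are stable under every matrix, the standard basis
    may be replaced by the rows of [B], eigenvectors of [g]; on a word in these, [g] acts by a
    product of entries of [D]. *)
Lemma tpow_factmod_trace M (Q : 'M_(tpow_dim d k, M))
    (r : 'I_M -> {ffun 'I_k -> 'I_d}) (B C : 'M_d) (D : 'rV_d) g :
    g \in G -> C *m B = 1%:M -> rG g = C *m diag_mx D *m B ->
    (forall u, S u -> u *m Q = 0) ->
    (forall f, ('e_(enum_rank f)
       - row (enum_rank f) Q *m rowsub (enum_rank \o r) 1%:M <= mxspan S)%MS) ->
  \tr (factmod_repr Smod g)
    = \sum_l \prod_j D 0 (r l j) * Q (enum_rank (r l)) l.
Proof.
move=> Gg CB rGg SQ QS; have BC := mulmx1C CB.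
have span_tpow A : (mxspan S *m tpow_mx k A <= mxspan S)%MS.
  by apply: mxspan_mulmx_sub => u /(@S_tpow u A); apply: (mxspanP S).1.
have spanQ : mxspan S *m Q = 0.
  by apply/eqP; rewrite -submx0; apply: mxspan_mulmx_sub => u /SQ ->; rewrite sub0mx.
set L := rowsub (enum_rank \o r) 1%:M in QS.
(* The lifts are words in the eigenvectors; [C] returns to their coordinates before [Q] is
   applied. *)
rewrite (factmod_trace _ (Q := tpow_mx k C *m Q) (S := L *m tpow_mx k B)) //.
- rewrite /= rGg !tpow_mxM tpow_mx_diag !mulmxA.
  rewrite -[L *m _ *m tpow_mx k C]mulmxA -tpow_mxM BC tpow_mx1 mulmx1.
  rewrite -[_ *m _ *m tpow_mx k C]mulmxA -tpow_mxM BC tpow_mx1 mulmx1 /L.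
  rewrite mul_rowsub_mx mul1mx.
  rewrite /mxtrace; apply: eq_bigr => l _.
  rewrite mul_rowsub_mx mul_diag_mx !mxE; congr (_ * _).
  by apply: eq_bigr => j _; rewrite /= enum_rankK.
- by have /submxP[X XE] := span_tpow C; rewrite mulmxA XE -mulmxA spanQ mulmx0.
have -> : 1%:M - tpow_mx k C *m Q *m (L *m tpow_mx k B)
    = tpow_mx k C *m (1%:M - Q *m L) *m tpow_mx k B.
  by rewrite mulmxBr mulmxBl mulmx1 -tpow_mxM CB tpow_mx1 !mulmxA.
have /submxP[X ->] : (1%:M - Q *m L <= mxspan S)%MS.
  apply/row_subP => a; rewrite linearB /= row1 row_mul.
  by have := QS (enum_val a); rewrite enum_valK.
by rewrite mulmxA -mulmxA mulmx_sub.
Qed.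

End TensorPower.

Section SymmetricPower.
Variables (d k : nat).
Implicit Types (f : {ffun 'I_k -> 'I_d}) (h : {ffun 'I_d -> 'I_k.+1}).

(** Exponent vector of the monomial that [f] represents in S^k. No exponent exceeds [k], so
    ['I_k.+1] suffices and [inord] changes nothing. *)
Definition multiplicity f : {ffun 'I_d -> 'I_k.+1} :=
  [ffun x => inord #|[pred j | f j == x]|].

Definition exponents := [set h : {ffun 'I_d -> 'I_k.+1} | (\sum_x h x == k)%N].

Lemma multiplicityE f x : multiplicity f x = #|[pred j | f j == x]| :> nat.
Proof. by rewrite ffunE inordK // ltnS -[X in (_ <= X)%N]card_ord max_card. Qed.

Lemma prod_multiplicity (F : fieldType) (D : 'I_d -> F) f :
  \prod_j D (f j) = \prod_x D x ^+ multiplicity f x.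
Proof.
rewrite (partition_big f xpredT) //=; apply: eq_bigr => x _.
rewrite multiplicityE -prodr_const.
by apply: eq_bigr => j /eqP->.
Qed.

Lemma multiplicity_exponents f : multiplicity f \in exponents.
Proof.
rewrite inE -[X in _ == X]card_ord -sum1_card (partition_big f xpredT) //=.
by apply/eqP/eq_bigr => x _; rewrite multiplicityE -sum1_card.
Qed.

Lemma multiplicity_count f x :
  multiplicity f x = count_mem x (map f (enum 'I_k)) :> nat.
Proof.
rewrite multiplicityE count_map -sum1_count big_enum_cond /=.
by rewrite -sum1_card.
Qed.

Lemma multiplicity_perm f1 f2 :
  multiplicity f1 = multiplicity f2 -> exists s : 'S_k, f1 =1 f2 \o s.
Proof.
move=> mf.
have /tuple_permP[s fs] : perm_eq [tuple f1 j | j < k] [tuple f2 j | j < k].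
  by apply/allP => x _ /=; rewrite -!multiplicity_count mf.
exists s => j; have := congr1 (fun t => tnth t j) (val_inj fs).
by rewrite !tnth_mktuple.
Qed.

Lemma multiplicity_surj h : h \in exponents -> exists f, multiplicity f = h.
Proof.
rewrite inE => /eqP hk.
(* The witness is the sorted word, with each letter [x] repeated [h x] times. *)
pose w := flatten [seq nseq (h x) x | x <- enum 'I_d].
have cw x : count_mem x w = h x.
  rewrite count_flatten -map_comp sumnE big_map big_enum /= (bigD1 x) //=.
  rewrite count_nseq /= eqxx mul1n big1 ?addn0 // => y yx.
  by rewrite count_nseq /= (negPf yx).
have sw : size w == k.
  rewrite size_flatten /shape -map_comp sumnE big_map big_enum /= -[X in _ == X]hk.
  by apply/eqP/eq_bigr => x _; rewrite size_nseq.
exists [ffun j => tnth (Tuple sw) j]; apply/ffunP => x; apply: val_inj => /=.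
rewrite multiplicity_count -[RHS]cw; congr count.
rewrite -[RHS](map_tnth_enum (Tuple sw)).
by apply: eq_map => j; rewrite ffunE.
Qed.

End SymmetricPower.

(** The monomials are a basis of S^k: extracting a coefficient ignores the order of the factors, and
    each word is congruent to the chosen word with its multiplicities. The trace is the complete
    homogeneous symmetric polynomial in the eigenvalues. *)
Lemma sym_repr_trace (F : fieldType) (gT : finGroupType) (G : {group gT})
    (d k : nat) (rG : mx_representation F G d) (B C : 'M_d) (D : 'rV_d) g :
    g \in G -> C *m B = 1%:M -> rG g = C *m diag_mx D *m B ->
  \tr (sym_repr rG k g)
    = \sum_(h in exponents d k) \prod_x D 0 x ^+ h x.
Proof.
move=> Gg CB rGg.
have /fin_all_exists[r rP] (l : 'I_#|exponents d k|) :
    exists f, multiplicity f = enum_val l.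
  by apply: multiplicity_surj; apply: enum_valP.
pose Q : 'M[F]_(tpow_dim d k, _) :=
  \matrix_(a < tpow_dim d k, l < #|exponents d k|)
    (multiplicity (enum_val a : {ffun 'I_k -> 'I_d}) == enum_val l)%:R.
have QE f l : Q (enum_rank f) l = (multiplicity f == enum_val l)%:R.
  by rewrite mxE enum_rankK.
rewrite (tpow_factmod_trace (Q := Q) (r := r) _ _ Gg CB rGg).
- rewrite [RHS]big_enum_val; apply: eq_bigr => l _.
  by rewrite QE rP eqxx mulr1 prod_multiplicity rP.
- move=> _ A [v [s ->]]; exists (fun j => v j *m A), s.
  by rewrite mulmxBl /= !pure_tensorM.
- move=> _ [v [s ->]]; rewrite mulmxBl; apply/eqP; rewrite subr_eq0.
  apply/eqP/rowP => l; rewrite !pure_tensor_mul.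
  (* Permuting the factors amounts to permuting the letters of [f], which preserves
     multiplicities. *)
  pose h (f : {ffun 'I_k -> 'I_d}) := [ffun j => f ((s^-1)%g j)].
  rewrite (reindex_inj (h := h)) /=; last first.
    move=> f1 f2 /ffunP e; apply/ffunP => j.
    by have := e (s j); rewrite !ffunE permK.
  apply: eq_bigr => f _; congr (_ * _).
    rewrite (reindex_inj (@perm_inj _ s)) /=.
    by apply: eq_bigr => j _; rewrite ffunE permK.
  rewrite !QE; congr (_ == _)%:R; apply/ffunP => x; apply: val_inj => /=.
  rewrite !multiplicityE -!sum1_card (reindex_inj (@perm_inj _ s)) /=.
  by apply: eq_bigl => j; rewrite !inE ffunE permK.
move=> f; pose l := enum_rank_in (multiplicity_exponents f) (multiplicity f).
have lE : enum_val l = multiplicity f.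
  by rewrite enum_rankK_in ?multiplicity_exponents.
have -> : row (enum_rank f) Q = 'e_l.
  by apply/rowP => l'; rewrite !mxE enum_rankK -lE (inj_eq enum_val_inj) eq_sym.
rewrite -rowE row_rowsub row1 /= -!pure_tensor_delta.
apply: (mxspanP _).1.
have [s fs] : exists s : 'S_k, r l =1 f \o s.
  by apply: multiplicity_perm; rewrite rP.
exists (fun j => 'e_(f j)), s; congr (_ - pure_tensor _).
by apply/funext => j /=; rewrite fs.
Qed.

(** * Exterior powers *)

Section ExteriorPower.
Variables (F : fieldType) (d k : nat).
Implicit Types (v : 'I_k -> 'rV[F]_d) (f : {ffun 'I_k -> 'I_d}).

Definition set_at v j (a : 'rV[F]_d) : 'I_k -> 'rV[F]_d :=
  fun j' => if j' == j then a else v j'.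

Lemma pure_tensor_set_atD v j a b :
  pure_tensor (set_at v j (a + b))
    = pure_tensor (set_at v j a) + pure_tensor (set_at v j b).
Proof.
apply/rowP => w; rewrite !mxE !(bigD1 (P := xpredT) j) //= /set_at eqxx mxE mulrDl.
by congr (_ * _ + _ * _); apply: eq_bigr => l /negPf ->.
Qed.

Let U := mxspan (@ext_rel F d k).

Lemma pure_tensor_alt v j1 j2 : j1 != j2 -> v j1 = v j2 -> (pure_tensor v <= U)%MS.
Proof. by move=> j12 vj; apply: (mxspanP _).1; exists v, j1, j2. Qed.

(** Polarisation: with [v j1 + v j2] in both slots the tensor is a relation, and expanding it leaves
    the two mixed terms. *)
Lemma pure_tensor_tperm v j1 j2 : j1 != j2 ->
  ((pure_tensor v + pure_tensor (v \o tperm j1 j2))%R <= U)%MS.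
Proof.
move=> j12; pose w a b := set_at (set_at v j1 a) j2 b.
have j21 : (j2 == j1) = false by rewrite eq_sym; apply: negPf.
(* Either slot may be filled last, so additivity holds in both. *)
have wC a b : w a b = set_at (set_at v j2 b) j1 a.
  apply/funext => j; rewrite /w /set_at.
  by case: (eqVneq j j2) => // ->; rewrite j21.
have alt a : (pure_tensor (w a a) <= U)%MS.
  by apply: (pure_tensor_alt j12); rewrite /w /set_at (negPf j12) !eqxx.
have wv : w (v j1) (v j2) = v.
  apply/funext => j; rewrite /w /set_at.
  by case: eqVneq => [-> //|_]; case: eqVneq => [->|].
have wt : w (v j2) (v j1) = v \o tperm j1 j2.
  apply/funext => j; rewrite /w /set_at /=.
  case: tpermP => [->|->|/eqP/negPf-> /eqP/negPf->] //.
    by rewrite (negPf j12) eqxx.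
  by rewrite eqxx.
have wDr a b c :
    pure_tensor (w c (a + b)) = pure_tensor (w c a) + pure_tensor (w c b).
  exact: pure_tensor_set_atD.
have wDl a b c :
    pure_tensor (w (a + b) c) = pure_tensor (w a c) + pure_tensor (w b c).
  by rewrite !wC; exact: pure_tensor_set_atD.
have wD a b : pure_tensor (w (a + b) (a + b)) =
    pure_tensor (w a a) + pure_tensor (w b b)
      + (pure_tensor (w a b) + pure_tensor (w b a)).
  by rewrite wDl !wDr [X in _ + X = _]addrC addrACA.
have := alt (v j1 + v j2); rewrite wD wv wt => U2.
have := addmx_sub (alt (v j1)) (alt (v j2)).
by rewrite -eqmx_opp => /(addmx_sub U2); rewrite addrC addKr.
Qed.

(** Induction on a factorisation of [s] into transpositions, each contributing one sign. *)
Lemma pure_tensor_perm v (s : 'S_k) :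
  (pure_tensor (v \o s) - (-1) ^+ s *: pure_tensor v <= U)%MS.
Proof.
have [ts -> ] := prod_tpermP s; elim: ts v => [|[j1 j2] ts IHts] v /=.
  rewrite big_nil odd_perm1 scale1r => _.
  rewrite [v \o _](_ : _ = v) ?subrr ?sub0mx //.
  by apply/funext => j /=; rewrite perm1.
rewrite big_cons /= => /andP[j12 /IHts{}IHts].
rewrite odd_permM odd_tperm j12 signr_addb expr1 mulN1r scaleNr opprK.
set s' := (\prod_(t <- ts) _)%g in IHts *.
have -> : v \o (tperm j1 j2 * s')%g = (v \o s') \o tperm j1 j2.
  by apply/funext => j /=; rewrite permM.
have := pure_tensor_tperm (v \o s') j12; move: (IHts v).
rewrite -eqmx_opp opprB => /addmx_sub H /H.
by rewrite addrA subrK addrC.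
Qed.

End ExteriorPower.

(** The words [r l], one for each k-subset, give a basis of the exterior power: minors vanish on the
    relations and tell the subsets apart. The trace is the elementary symmetric polynomial in the
    eigenvalues. *)
Lemma ext_repr_trace (F : fieldType) (gT : finGroupType) (G : {group gT})
    (d k : nat) (rG : mx_representation F G d) (B C : 'M_d) (D : 'rV_d) g :
    g \in G -> C *m B = 1%:M -> rG g = C *m diag_mx D *m B ->
  \tr (ext_repr rG k g)
    = \sum_(A : {set 'I_d} | #|A| == k) \prod_(x in A) D 0 x.
Proof.
move=> Gg CB rGg; set P := [set A : {set 'I_d} | #|A| == k].
have /fin_all_exists[r rP] (l : 'I_#|P|) :
    exists f : {ffun 'I_k -> 'I_d}, injective f /\ f @: 'I_k = enum_val l.
  (* Eliminating the equation replaces [k] by the size of the subset, so that [enum_val] lists its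
     elements. *)
  have := enum_valP l; rewrite inE => /eqP; case: _ / => /=.
  exists [ffun j => enum_val j]; split=> [j1 j2|].
    by rewrite !ffunE => /enum_val_inj.
  apply/setP => x; apply/imsetP/idP => [[j _ ->]|xA].
    by rewrite ffunE enum_valP.
  by exists (enum_rank_in xA x); rewrite ?inE ?ffunE ?enum_rankK_in.
(* Column [l] is the minor on the columns [r l], the form dual to the wedge of the letters of
   [r l]. *)
pose Q : 'M[F]_(tpow_dim d k, _) :=
  \matrix_(a < tpow_dim d k, l < #|P|)
    \det (\matrix_(j1 < k, j2 < k)
            ((enum_val a : {ffun 'I_k -> 'I_d}) j1 == r l j2)%:R).
have QE f l : Q (enum_rank f) l = \det (\matrix_(j1, j2) (f j1 == r l j2)%:R).
  by rewrite mxE enum_rankK.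
have Qr l : Q (enum_rank (r l)) l = 1.
  rewrite QE -[RHS](det1 F k); congr (\det _); apply/matrixP => j1 j2.
  by rewrite !mxE (inj_eq (rP l).1).
have Q0 l l' : l != l' -> Q (enum_rank (r l)) l' = 0.
  (* The subsets have equal size, so some letter of the first is missing from the second and gives a
     zero row. *)
  move=> ll'; have /subsetPn[x xl xl'] : ~~ (enum_val l \subset enum_val l').
    apply: contra ll' => sll'; rewrite -(inj_eq enum_val_inj) eqEcard sll' /=.
    have := enum_valP l; have := enum_valP l'.
    by rewrite !inE => /eqP-> /eqP->.
  move: xl; rewrite -(rP l).2 => /imsetP[j _ xE].
  rewrite QE (expand_det_row _ j) big1 // => j' _; rewrite mxE.
  case: eqP => [rE|]; last by rewrite mul0r.
  by rewrite xE rE -(rP l').2 imset_f in xl'.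
have Qs (f : {ffun 'I_k -> 'I_d}) (s : 'S_k) l :
    Q (enum_rank [ffun j => f (s j)]) l = (-1) ^+ s * Q (enum_rank f) l.
  rewrite !QE -det_perm -det_mulmx; congr (\det _).
  by rewrite -row_permE; apply/matrixP => j1 j2; rewrite !mxE ffunE.
have vQ v l :
    (pure_tensor v *m Q) 0 l = \det (\matrix_(j1, j2) v j1 0 (r l j2)).
  rewrite pure_tensor_mul.
  under eq_bigr do rewrite QE mulr_sumr.
  rewrite exchange_big; apply: eq_bigr => s _ /=.
  under eq_bigr do rewrite mulrCA.
  rewrite -mulr_sumr; congr (_ * _).
  transitivity (\prod_j \sum_x v j 0 x * (x == r l (s j))%:R).
    rewrite bigA_distr_bigA; apply: eq_bigr => f _ /=; rewrite -big_split /=.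
    by apply: eq_bigr => j _; rewrite mxE.
  apply: eq_bigr => j _; rewrite mxE (bigD1 (r l (s j))) //= eqxx mulr1.
  by rewrite big1 ?addr0 // => x /negPf ->; rewrite mulr0.
rewrite (tpow_factmod_trace (Q := Q) (r := r) _ _ Gg CB rGg).
- transitivity (\sum_(A in P) \prod_(x in A) D 0 x).
    rewrite [RHS]big_enum_val; apply: eq_bigr => l _.
    rewrite Qr mulr1 -(rP l).2 big_imset //=.
    by move=> j1 j2 _ _; apply: (rP l).1.
  by apply: eq_bigl => A; rewrite inE.
- move=> _ A [v [j1 [j2 [j12 vj ->]]]].
  by exists (fun j => v j *m A), j1, j2; rewrite vj pure_tensorM.
- move=> _ [v [j1 [j2 [j12 vj ->]]]]; apply/rowP => l; rewrite vQ mxE.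
  by apply: (determinant_alternate j12) => j; rewrite !mxE vj.
(* A word with a repeated letter is itself a relation and has zero coordinates; an injective one is,
   up to sign, the chosen word on its image. *)
move=> f; have [finj|] := boolP (injectiveb f); last first.
  move=> /injectivePn[j1 [j2 j12 fj]].
  have -> : row (enum_rank f) Q = 0.
    apply/rowP => l; rewrite mxE QE [RHS]mxE.
    by apply: (determinant_alternate j12) => j; rewrite !mxE fj.
  rewrite mul0mx subr0 -pure_tensor_delta; apply: (pure_tensor_alt j12).
  by rewrite fj.
move/injectiveP: finj => finj.
have fP : f @: 'I_k \in P by rewrite inE card_imset // card_ord.
pose l := enum_rank_in fP (f @: 'I_k).
have lE : enum_val l = f @: 'I_k by rewrite enum_rankK_in.
have [s fs] : exists s : 'S_k, f =1 r l \o s.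
  have /fin_all_exists[t tP] (j : 'I_k) : exists j' : 'I_k, f j = r l j'.
    have : f j \in enum_val l by rewrite lE imset_f.
    by rewrite -(rP l).2 => /imsetP[j' _ ->]; exists j'.
  have tinj : injective t.
    by move=> j1 j2 tj; apply: finj; rewrite !tP tj.
  by exists (perm tinj) => j; rewrite /= permE.
have fE : f = [ffun j => r l (s j)] by apply/ffunP => j; rewrite ffunE fs.
have -> : row (enum_rank f) Q = (-1) ^+ s *: 'e_l.
  apply/rowP => l'; rewrite mxE fE Qs [RHS]mxE [in RHS]mxE eqxx /=.
  have [<-|ll'] := eqVneq l l'; first by rewrite Qr.
  by rewrite Q0.
rewrite -scalemxAl -rowE row_rowsub row1 /= -!pure_tensor_delta.
have -> : (fun j => 'e_(f j)) = (fun j => 'e_(r l j)) \o s :> ('I_k -> 'rV[F]_d).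
  by apply/funext => j; rewrite fs.
exact: pure_tensor_perm.
Qed.

(** * Power series *)

Section FpsCoefficients.
Variable R : comNzRingType.
Implicit Types f g : fps R.

Lemma fps_coefCM (c : R) f k : (fpsC c * f) k = c * f k.
Proof.
rewrite fps_coefM big_ord_recl subn0 big1 ?addr0 // => j _.
by rewrite /= mul0r.
Qed.

Fact fpsC_is_zmod_morphism : zmod_morphism (@fpsC R).
Proof. by move=> a b; apply/fpsP => -[|k] //=; rewrite subrr. Qed.

Fact fpsC_is_monoid_morphism : monoid_morphism (@fpsC R).
Proof.
split=> // a b; apply/fpsP => k; rewrite fps_coefCM /=.
by case: eqP; rewrite ?mulr0.
Qed.

HB.instance Definition _ :=
  GRing.isZmodMorphism.Build R (fps R) (@fpsC R) fpsC_is_zmod_morphism.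
HB.instance Definition _ :=
  GRing.isMonoidMorphism.Build R (fps R) (@fpsC R) fpsC_is_monoid_morphism.

Lemma fps_coefN f k : (- f) k = - f k.
Proof. by []. Qed.

Lemma fps_coefXnM d f k :
  (fpsX R ^+ d * f) k = if (k < d)%N then 0 else f (k - d)%N.
Proof.
elim: d k => [|d IHd] k; first by rewrite expr0 mul1r subn0.
by rewrite exprS -mulrA fps_coefXM; case: k => // k; rewrite IHd ltnS subSS.
Qed.

(** Truncation beyond degree [k] leaves this coefficient unchanged and reduces products of series to
    products of polynomials. *)
Lemma fps_coef_prod_trunc (I : Type) (r : seq I) (f : I -> fps R) k n :
  (k <= n)%N ->
  (\prod_(x <- r) f x) k = (\prod_(x <- r) fps_trunc n (f x))`_k.
Proof.
elim: r k => [|x r IHr] k kn; first by rewrite !big_nil coef1 /=; case: eqP.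
rewrite !big_cons fps_coefM coefM; apply: eq_bigr => j _.
rewrite coef_poly ltnS (leq_trans _ kn) ?IHr ?(leq_trans (leq_subr _ _) kn) //.
by rewrite -ltnS.
Qed.

(** Applied to geometric series, this produces the complete homogeneous symmetric polynomials. *)
Lemma fps_coef_prod d (f : 'I_d -> fps R) p :
  (\prod_x f x) p = \sum_(h in exponents d p) \prod_x f x (h x).
Proof.
rewrite (@fps_coef_prod_trunc _ _ _ p p) //.
under eq_bigr do rewrite /fps_trunc poly_def.
rewrite bigA_distr_bigA coef_sum [RHS]big_mkcond /=.
apply: eq_bigr => h _; rewrite scaler_prod prodrXr coefZ coefXn inE eq_sym.
by case: eqP; rewrite ?mulr1 ?mulr0.
Qed.

(** [A] is the set of factors that contribute their linear term. *)
Lemma fps_coef_prod1D d (a : 'I_d -> R) m :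
  (\prod_x (1 + fpsC (a x) * fpsX R)) m
    = \sum_(A : {set 'I_d} | #|A| == m) \prod_(x in A) a x.
Proof.
under eq_bigr do rewrite addrC.
rewrite bigA_distr fps_coef_sum [RHS]big_mkcond /=.
apply: eq_bigr => A _.
transitivity ((fpsC (\prod_(x in A) a x) * fpsX R ^+ #|A|) m).
  by rewrite rmorph_prod -prodr_const -big_split -big_mkcond.
rewrite fps_coefCM fps_coefXn eq_sym.
by case: eqP; rewrite ?mulr1 ?mulr0.
Qed.

Lemma fps_geometric (a : R) :
  Fps (fun j => a ^+ j) * (1 - fpsC a * fpsX R) = 1.
Proof.
rewrite mulrC mulrBl mul1r -mulrA; apply/fpsP => k.
rewrite fps_coefD fps_coefN fps_coefCM fps_coefXM.
by case: k => [|k] /=; rewrite ?mulr0 ?subr0 // exprS subrr.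
Qed.

Lemma fps_coef_fps_sum (F : nat -> fps R) k :
  fps_sum F k = \sum_(b < k.+1) (F b) k.
Proof. by []. Qed.

Lemma fps_coef_sum_pow (c : nat -> R) d k : (0 < d)%N ->
  fps_sum (fun b => fpsC (c b) * fpsX R ^+ (b * d)) k
    = if (d %| k)%N then c (k %/ d)%N else 0.
Proof.
move=> d0; rewrite fps_coef_fps_sum.
under eq_bigr do rewrite fps_coefCM fps_coefXn.
case: dvdnP => [[q ->]|ndk].
  (* Only [b = q] contributes; it is in range because [q <= q * d]. *)
  rewrite mulnK // (bigD1 (Ordinal (leq_pmulr q d0 : q < (q * d).+1)%N)) //=.
  rewrite eqxx mulr1 big1 ?addr0 // => b.
  by rewrite -val_eqE /= eqn_pmul2r // eq_sym => /negPf->; rewrite mulr0.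
rewrite big1 // => b _; case: eqP => [kE|]; last by rewrite mulr0.
by case: ndk; exists b.
Qed.

(* ['C(q + b - 1, b)] makes the identity valid at [q = 0], where the induction
   starts. *)
Lemma fps_negative_binomial d q : (0 < d)%N ->
  fps_sum (fun b => fpsC 'C(q + b - 1, b)%:R * fpsX R ^+ (b * d))
    * (1 - fpsX R ^+ d) ^+ q = 1.
Proof.
move=> d0; elim: q => [|q IHq].
  rewrite expr0 mulr1; apply/fpsP => k.
  rewrite fps_coef_sum_pow // add0n; case: k => [|k]; first by rewrite dvdn0 div0n.
  case: ifP => // dk /=; rewrite bin_small // subn1 prednK //.
  by rewrite divn_gt0 // dvdn_leq.
(* It remains that the series for [q + 1] times [1 - X^d] is the series for [q]: on coefficients,
   Pascal's rule. *)
rewrite exprS mulrA -[RHS]IHq; congr (_ * _).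
rewrite mulrC mulrBl mul1r; apply/fpsP => k.
rewrite fps_coefD fps_coefN fps_coefXnM !fps_coef_sum_pow //.
case: ltnP => kd.
  rewrite subr0; case: dvdnP => // -[b kE]; move: kd; rewrite kE.
  rewrite -[X in (_ < X)%N]mul1n ltn_pmul2r // ltnS leqn0 => /eqP ->.
  by rewrite !div0n !bin0.
rewrite -(subnK kd); move: (k - d)%N => j; rewrite addnK.
rewrite dvdn_addl // divnDr // divnn d0; case: ifP => _; last by rewrite subrr.
by rewrite !addn1 !addnS !subn1 /= addSn binS natrD addrK.
Qed.

End FpsCoefficients.

(** * Products over the powers of a root of unity *)

Lemma primitive_rootV (F : fieldType) d (w : F) :
  d.-primitive_root w^-1 = d.-primitive_root w.
Proof.
rewrite /primitive_root_of_unity; congr (_ && _); apply: eq_forallb => j.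
by rewrite !unity_rootE exprVn invr_eq1.
Qed.

(** Each factor is [-w^x (X - w^-x)], and the [w^-x] are the roots of [X^d - 1]; evaluation at 0
    gives the remaining constant. *)
Lemma prod_1subX_prim (F : fieldType) d (w : F) : d.-primitive_root w ->
  \prod_(0 <= x < d) (1 - (w ^+ x)%:P * 'X) = 1 - 'X^d.
Proof.
move=> wP; have d0 := prim_order_gt0 wP.
have w0 : w != 0.
  apply/eqP => w0; have /eqP := prim_expr_order wP.
  by rewrite w0 expr0n gtn_eqF // eq_sym oner_eq0.
have wVP : d.-primitive_root w^-1.
  by rewrite primitive_rootV.
pose c := \prod_(0 <= x < d) - (w ^+ x).
have E : \prod_(0 <= x < d) (1 - (w ^+ x)%:P * 'X) = c%:P * ('X^d - 1).
  rewrite -(factor_Xn_sub_1 wVP) rmorph_prod -big_split /=.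
  apply: eq_bigr => x _; rewrite mulrBr -polyCM exprVn mulNr mulfV ?expf_neq0 //.
  by rewrite !polyCN opprK mulNr addrC.
have cE : c = -1.
  have := congr1 (horner^~ 0) E; rewrite !hornerE horner_prod big1 /=.
    by rewrite expr0n gtn_eqF // sub0r mulrN1 => ->; rewrite opprK.
  by move=> x _; rewrite !hornerE /= ?mulr0 subr0.
by rewrite E cE polyCN mulN1r opprB.
Qed.

(** The powers of [w] have period [d], so the product splits into [n/d] equal blocks, each the
    polynomial identity carried along [phi] and evaluated at [y]. *)
Lemma prod_1sub_prim (F : fieldType) (S : comNzRingType)
    (phi : {rmorphism F -> S}) d n (w : F) (y : S) :
    d.-primitive_root w -> (d %| n)%N ->
  \prod_(x < n) (1 - phi (w ^+ x) * y) = (1 - y ^+ d) ^+ (n %/ d).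
Proof.
move=> wP /dvdnP[q ->]; rewrite mulnK ?(prim_order_gt0 wP) //.
have base : \prod_(0 <= x < d) (1 - phi (w ^+ x) * y) = 1 - y ^+ d.
  have := congr1 (fun p => horner_eval y (map_poly phi p)) (prod_1subX_prim wP).
  rewrite !rmorph_prod !rmorphB !rmorph1 !rmorphXn /= map_polyX.
  rewrite /horner_eval hornerX => <-; apply: eq_bigr => x _.
  by rewrite rmorphB rmorph1 rmorphM /= map_polyC map_polyX !hornerE.
rewrite -(big_mkord xpredT (fun x => 1 - phi (w ^+ x) * y)).
elim: q => [|q IHq]; first by rewrite mul0n big_geq.
rewrite mulSnr (big_cat_nat (leq0n (q * d)%N) (leq_addr _ _)) /= IHq exprSr.
congr (_ * _); rewrite -[X in \prod_(X <= _ < _) _]add0n big_addn addKn.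
rewrite -base; apply: eq_bigr => x _.
by rewrite exprD mulnC exprM (prim_expr_order wP) expr1n mulr1.
Qed.

(** * The regular representation and Ramanujan sums *)

Lemma big_cycle (R : Type) (idx : R) (op : Monoid.com_law idx)
    (gT : finGroupType) (gam : gT) (f : gT -> R) :
  \big[op/idx]_(g in <[gam]>%g) f g = \big[op/idx]_(k < #[gam]%g) f (gam ^+ k)%g.
Proof.
have inj : {in 'I_#[gam]%g &, injective (fun k : 'I_#[gam]%g => (gam ^+ k)%g)}.
  move=> a b _ _ /eqP; rewrite eq_expg_mod_order !modn_small // => /eqP.
  exact: val_inj.
rewrite -(big_imset f inj); apply: eq_bigl => g.
apply/idP/imsetP => [/cyclePmin[k ko ->]|[k _ ->]]; last exact: mem_cycle.
by exists (Ordinal ko).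
Qed.

Section CyclicRegular.
Variables (F : fieldType) (gT : finGroupType) (G : {group gT}) (gam : gT).
Variable zeta : F.
Hypothesis gam_gen : G :=: <[gam]>%g.
Hypothesis zeta_prim : #|G|.-primitive_root zeta.
Hypothesis card_neq0 : #|G|%:R != 0 :> F.

Let order_gam : #[gam]%g = #|G|. Proof. by rewrite gam_gen. Qed.
Let zeta1 : zeta ^+ #[gam]%g = 1.
Proof. by rewrite order_gam (prim_expr_order zeta_prim). Qed.
Let zeta_neq0 : zeta != 0.
Proof.
apply/eqP => z0; have /eqP := zeta1.
by rewrite z0 expr0n order_gam gtn_eqF ?cardG_gt0 // eq_sym oner_eq0.
Qed.

Let sumG (f : gT -> F) :
  \sum_(g in G) f g = \sum_(k < #|G|) f (gam ^+ k)%g.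
Proof. by rewrite -order_gam -big_cycle; apply: eq_bigl => g; rewrite gam_gen. Qed.

Lemma cyc_char_neq0 a g : cyc_char gam zeta a g != 0.
Proof. by rewrite expf_neq0. Qed.

Lemma cyc_char_mul a :
  {in G &, {morph cyc_char gam zeta a : x y / (x * y)%g >-> x * y}}.
Proof. by rewrite gam_gen; apply: cyc_charM. Qed.

(** For [a != b] this is a geometric sum whose ratio [zeta^(b - a)] differs from 1 but has [#|G|]-th
    power 1. *)
Lemma cyc_char_orthogonality (a b : 'I_#|G|) :
  \sum_(g in G) (cyc_char gam zeta a g)^-1 * cyc_char gam zeta b g
    = if a == b then #|G|%:R else 0.
Proof.
have [->|ab] := eqVneq a b.
  under eq_bigr do rewrite mulVf ?cyc_char_neq0 //.
  by rewrite sumr_const.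
rewrite sumG; set z := (zeta ^+ a)^-1 * zeta ^+ b.
under eq_bigr do rewrite !cyc_charX // !exprM -exprVn -exprMn -/z.
have z1 : z - 1 != 0.
  rewrite subr_eq0; apply: contra ab => /eqP z1; apply/eqP/val_inj/eqP.
  have : zeta ^+ b == zeta ^+ a by rewrite -[X in _ == X]mulr1 -z1 mulVKf ?expf_neq0.
  by rewrite (eq_prim_root_expr zeta_prim) !modn_small // eq_sym.
apply: (mulfI z1); rewrite -subrX1 mulr0 /z exprMn exprVn -!exprM.
rewrite ![(_ * #|G|)%N]mulnC !exprM (prim_expr_order zeta_prim).
by rewrite !expr1n invr1 mulr1 subrr.
Qed.

(** Discrete Fourier transform: row [a] of [B] is the sum of the [chi_a(h)^-1 e_h], and
    [e_h g = e_(h g)] makes it an eigenvector for [chi_a(g)]. *)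
Lemma regular_repr_diag :
  exists B C : 'M[F]_#|G|, C *m B = 1%:M /\
    forall g, g \in G ->
      regular_repr F G g = C *m diag_mx (\row_a cyc_char gam zeta a g) *m B.
Proof.
pose B : 'M[F]_#|G| := \matrix_(a, j) (cyc_char gam zeta a (enum_val j))^-1.
pose C : 'M[F]_#|G| :=
  \matrix_(j, b) (#|G|%:R^-1 * cyc_char gam zeta b (enum_val j)).
have BC : B *m C = 1%:M.
  apply/matrixP => a b; rewrite !mxE; under eq_bigr do rewrite !mxE mulrCA.
  rewrite -mulr_sumr.
  rewrite -(big_enum_val
    (fun g => (cyc_char gam zeta a g)^-1 * cyc_char gam zeta b g)).
  rewrite cyc_char_orthogonality; case: eqP => _; last by rewrite mulr0.
  by rewrite mulVf.
exists B, C; split=> [|g Gg]; first exact: mulmx1C.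
rewrite -[LHS]mul1mx -(mulmx1C BC) -!mulmxA; congr (_ *m _).
apply/matrixP => a j; rewrite mul_diag_mx !mxE.
have Gj := enum_valP j; have Gjg : (enum_val j * g^-1)%g \in G.
  by rewrite groupM ?groupV.
(* Translation by [g] reaches position [j] only from [j g^-1]. *)
rewrite (bigD1 (gring_index G (enum_val j * g^-1)%g)) //= !mxE.
rewrite gring_indexK // mulgKV gring_valK !eqxx mulr1 big1 ?addr0 => [|l lj].
  have := cyc_char_mul a Gjg Gg; rewrite mulgKV => ->.
  by rewrite invfM mulrCA mulfV ?mulr1 ?cyc_char_neq0.
rewrite !mxE eqxx /=; case: eqP => [jE|]; last by rewrite mulr0.
case/eqP: lj; rewrite jE gring_indexK ?groupM ?enum_valP //.
by rewrite mulgK gring_valK.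
Qed.

Lemma dim_sym_ext i p m :
  (\rank (isotypic (sym_ext_repr (regular_repr F G) p m)
                   (cyc_char gam zeta i)))%:R
  = #|G|%:R^-1 * \sum_(k < #|G|) (zeta ^+ (i * k))^-1 *
      ((\sum_(h in exponents #|G| p) \prod_(x < #|G|) (zeta ^+ k) ^+ x ^+ h x) *
       (\sum_(A : {set 'I_#|G|} | #|A| == m) \prod_(x in A) (zeta ^+ k) ^+ x)).
Proof.
rewrite rank_isotypic //; last first.
- exact: cyc_char_mul.
- by move=> g _; apply: cyc_char_neq0.
congr (_ * _); have [B [C [CB diagE]]] := regular_repr_diag.
under eq_bigr => g Gg do
  rewrite /= mxtrace_prod (sym_repr_trace _ Gg CB (diagE g Gg))
    (ext_repr_trace _ Gg CB (diagE g Gg)).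
have rowE k x : (\row_a cyc_char gam zeta a (gam ^+ k)%g) 0 x
    = (zeta ^+ k) ^+ x :> F.
  by rewrite mxE cyc_charX // mulnC exprM.
rewrite sumG; apply: eq_bigr => k _.
rewrite cyc_charX //; congr (_ * (_ * _)); apply: eq_bigr => h _.
  by apply: eq_bigr => x _; rewrite rowE.
by apply: eq_bigr => x _; rewrite rowE.
Qed.

End CyclicRegular.

Section RamanujanSum.
Variables (F : fieldType) (n : nat) (zeta : F).
Hypothesis zeta_prim : n.-primitive_root zeta.

(** Since [d] divides [n], the primitive d-th roots are powers of [zeta]; inversion permutes them,
    which accounts for the inverses brought in by the projection formula. *)
Lemma ramanujan_sumE d i : (d %| n)%N ->
  ramanujan_sum F d i
    = \sum_(k < n | d.-primitive_root (zeta ^+ k)) (zeta ^+ (i * k))^-1.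
Proof.
move=> dn.
pose s := [seq (zeta ^+ k)^-1 | k : 'I_n <- enum 'I_n
                                & d.-primitive_root (zeta ^+ k)].
have us : uniq s.
  rewrite map_inj_in_uniq ?filter_uniq -?enumT ?enum_uniq //.
  move=> a b _ _ /invr_inj/eqP.
  by rewrite (eq_prim_root_expr zeta_prim) !modn_small // => /eqP/val_inj.
rewrite /ramanujan_sum.
have -> : [set z : F | d.-primitive_root z]%classic = [set` s]%classic.
  apply/seteqP; split=> z /=.
    move=> zd; have zVn : z^-1 ^+ n = 1.
      by apply/eqP; rewrite exprVn invr_eq1 -(prim_order_dvd zd).
    have [k kE] := prim_rootP zeta_prim zVn.
    apply/mapP; exists k; last by rewrite -kE invrK.
    by rewrite mem_filter -kE primitive_rootV zd mem_enum.
  by case/mapP => k; rewrite mem_filter => /andP[kd _] ->; rewrite primitive_rootV.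
rewrite -fsbig_seq // big_map big_filter big_enum_cond /=.
by apply: eq_bigr => k _; rewrite exprVn -exprM mulnC.
Qed.

(** Each [zeta^k] has exactly one order, a divisor of [n]. The argument [d] of [f] lets the summand
    be written in terms of that order. *)
Lemma sum_by_primitive_order (V : nmodType) (f : nat -> 'I_n -> V) (g : 'I_n -> V) :
    (forall d (k : 'I_n), (d %| n)%N -> d.-primitive_root (zeta ^+ k) ->
       f d k = g k) ->
  \sum_(d <- divisors n) \sum_(k < n | d.-primitive_root (zeta ^+ k)) f d k
    = \sum_(k < n) g k.
Proof.
move=> fg; rewrite (exchange_big_dep xpredT) //=; apply: eq_bigr => k _.
have n0 := prim_order_gt0 zeta_prim.
have kn : (zeta ^+ k) ^+ n = 1 by rewrite exprAC (prim_expr_order zeta_prim) expr1n.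
have [d dk dn] := prim_order_exists n0 kn.
rewrite -big_filter (_ : filter _ _ = [:: d]) ?big_seq1 ?fg //.
rewrite -(filter_pred1_uniq (divisors_uniq n)) -?dvdn_divisors //.
apply: eq_filter => e /=; apply/idP/eqP => [ek|-> //]; apply/eqP.
rewrite eqn_dvd (prim_order_dvd dk) (prim_order_dvd ek).
by rewrite (prim_expr_order ek) (prim_expr_order dk) eqxx.
Qed.

End RamanujanSum.

(** * Bivariate generating functions *)

Section TwoVariables.
Variable F : fieldType.
Local Notation cst := (@fps2_cst F).
Local Notation s := (fps2_s F).
Local Notation t := (fps2_t F).

Fact fps2_cst_is_zmod_morphism : zmod_morphism cst.
Proof. by move=> a b; rewrite /fps2_cst !rmorphB. Qed.

Fact fps2_cst_is_monoid_morphism : monoid_morphism cst.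
Proof. by split=> [|a b]; rewrite /fps2_cst ?rmorph1 ?rmorphM. Qed.

HB.instance Definition _ := GRing.isZmodMorphism.Build F {fps2 F} cst
  fps2_cst_is_zmod_morphism.
HB.instance Definition _ := GRing.isMonoidMorphism.Build F {fps2 F} cst
  fps2_cst_is_monoid_morphism.

Lemma fps2_coef_cstM a (f : {fps2 F}) p m : (cst a * f) p m = a * f p m.
Proof. by rewrite /fps2_cst !fps_coefCM. Qed.

Lemma fps2_coef_sum (I : Type) (r : seq I) (P : pred I) (f : I -> {fps2 F}) p m :
  (\sum_(i <- r | P i) f i) p m = \sum_(i <- r | P i) f i p m.
Proof. by rewrite !fps_coef_sum. Qed.

(** The negative binomial series with exponent 1 inverts [1 - s^d]. *)
Lemma sub1_sX_unit d q : (0 < d)%N -> (1 - s ^+ d) ^+ q \is a GRing.unit.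
Proof.
move=> d0; apply: unitrX; apply/unitrP.
have := fps_negative_binomial (fps F) 1 d0; rewrite expr1 -/s.
by set f := fps_sum _ => fE; exists f; split; rewrite // mulrC.
Qed.

Lemma fps2_gf_weights d n w : d.-primitive_root w -> (d %| n)%N ->
  fps2_gf (fun p m =>
      (\sum_(h in exponents n p) \prod_(x < n) (w ^+ x) ^+ h x)
      * \sum_(A : {set 'I_n} | #|A| == m) \prod_(x in A) w ^+ x)
  = (1 - (- t) ^+ d) ^+ (n %/ d) / (1 - s ^+ d) ^+ (n %/ d).
Proof.
move=> wd dn.
(* The inverse of [1 - w^x s]. Below, the factor in [t] is a constant for the outer variable [s]. *)
pose geo (x : 'I_n) : {fps2 F} := Fps (fun j => fpsC (w ^+ x) ^+ j).
transitivity (fpsC (\prod_(x < n) (1 + fpsC (w ^+ x) * fpsX F)) * \prod_x geo x).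
  apply/fpsP => p; rewrite fps_coefCM fps_coef_prod mulrC.
  transitivity (fpsC (\sum_(h in exponents n p) \prod_(x < n) (w ^+ x) ^+ h x)
     * \prod_(x < n) (1 + fpsC (w ^+ x) * fpsX F)).
    by apply/fpsP => m; rewrite fps_coefCM fps_coef_prod1D.
  congr (_ * _); rewrite rmorph_sum; apply: eq_bigr => h _.
  by rewrite rmorph_prod; apply: eq_bigr => x _; rewrite rmorphXn.
have -> : fpsC (\prod_(x < n) (1 + fpsC (w ^+ x) * fpsX F))
    = (1 - (- t) ^+ d) ^+ (n %/ d).
  (* Here [y = -t], because [1 + w^x t = 1 - w^x (-t)]. *)
  rewrite -(prod_1sub_prim cst _ wd dn) rmorph_prod; apply: eq_bigr => x _.
  by rewrite rmorphD rmorph1 rmorphM mulrN opprK.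
congr (_ * _); apply: (mulIr (sub1_sX_unit (n %/ d) (prim_order_gt0 wd))).
rewrite mulVr ?sub1_sX_unit ?(prim_order_gt0 wd) //.
(* With [y = s], each geometric series meets its inverse. *)
rewrite -(prod_1sub_prim cst _ wd dn) -big_split big1 //= => x _.
exact: fps_geometric.
Qed.

(** The sign combines [(-1)^a] from the binomial theorem with [(-1)^(d a)] from the powers of
    [-t]. *)
Lemma numerator_expand d q :
  (1 - (- t) ^+ d) ^+ q
    = \sum_(0 <= a < q.+1)
        (-1) ^+ (d.+1 * a) * cst 'C(q, a)%:R * t ^+ (a * d).
Proof.
rewrite exprBn big_mkord; apply: eq_bigr => a _.
rewrite expr1n mulr1 -exprM (exprNn t) mulrA -exprD -mulSn -mulr_natr.
by rewrite rmorph_nat (mulnC d a) mulrAC.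
Qed.

(** Negative binomial series, rewritten by the symmetry of binomial coefficients, where [q > 0]
    keeps [q - 1] from being truncated. *)
Lemma denominator_inv d q : (0 < d)%N -> (0 < q)%N ->
  ((1 - s ^+ d) ^+ q)^-1
    = fps_sum (fun b => cst 'C(q + b - 1, q - 1)%:R * s ^+ (b * d)).
Proof.
move=> d0 q0; apply: (mulIr (sub1_sX_unit q d0)).
rewrite mulVr ?sub1_sX_unit // -[LHS](fps_negative_binomial (fps F) q d0).
congr (_ * _); congr (fps_sum _); apply/funext => b; congr (_ * _).
rewrite !rmorph_nat -(bin_sub (leq_sub2r 1 (leq_addr b q))).
by case: q q0 => // q _; rewrite addSn !subn1 /= addKn.
Qed.

(** Only the terms [a = m/d] and [b = p/d] reach this coefficient. *)
Lemma coef_numerator_denominator d q p m : (0 < d)%N ->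
  ((\sum_(0 <= a < q.+1) (-1) ^+ (d.+1 * a) * cst 'C(q, a)%:R * t ^+ (a * d))
    * fps_sum (fun b => cst 'C(q + b - 1, q - 1)%:R * s ^+ (b * d))) p m
  = if (d %| p)%N && (d %| m)%N
    then (-1) ^+ (d.+1 * (m %/ d)) * ('C(q, m %/ d) * 'C(q + p %/ d - 1, q - 1))%:R
    else 0.
Proof.
move=> d0.
have -> : \sum_(0 <= a < q.+1) (-1) ^+ (d.+1 * a) * cst 'C(q, a)%:R * t ^+ (a * d)
    = fpsC (\sum_(0 <= a < q.+1)
              fpsC ((-1) ^+ (d.+1 * a) * 'C(q, a)%:R) * fpsX F ^+ (a * d)).
  rewrite rmorph_sum; apply: eq_bigr => a _.
  by rewrite !rmorphM rmorphXn rmorphN1 !rmorph_nat rmorphXn rmorphN1 rmorphXn.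
rewrite fps_coefCM fps_coef_sum_pow //; case: (d %| p)%N; last by rewrite mulr0.
rewrite mulrC fps_coefCM fps_coef_sum.
under eq_bigr do rewrite fps_coefCM fps_coefXn.
case: dvdnP => [[a ->]|ndm] /=.
  rewrite mulnK //.
  pose f a' : F := if a' == a then (-1) ^+ (d.+1 * a) * 'C(q, a)%:R else 0.
  rewrite (eq_bigr f); last first.
    move=> a' _; rewrite /f eqn_pmul2r // eq_sym.
    case: eqP => [->|_]; last by rewrite mulr0.
    by rewrite mulr1.
  rewrite -big_mkcond big_mkord.
  (* For [a > q] the sum has no such term, in agreement with the vanishing of ['C(q, a)]. *)
  have [aq|qa] := leqP a q.
    rewrite (big_pred1 (Ordinal (aq : (a < q.+1)%N))) //.
    by rewrite natrM mulrA mulrC.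
  by rewrite (bin_small qa) mul0n !mulr0 big1 ?mulr0.
rewrite big1 ?mulr0 // => a _; case: eqP => [mE|]; rewrite ?mulr0 //.
by case: ndm; exists a.
Qed.

End TwoVariables.

(** * Multinomial coefficients and the final formula *)

Lemma multinomial3E a b c :
  multinomial3 a b c = ('C(a + b + c, b) * 'C(a + c, a))%N.
Proof.
rewrite /multinomial3; have e1 := bin_fact (leq_addr c a).
have e2 : ('C(a + b + c, b) * (b`! * (a + c)`!) = (a + b + c)`!)%N.
  have ble : (b <= a + b + c)%N by rewrite addnAC leq_addl.
  by rewrite -(bin_fact ble) addnAC addnK.
rewrite -e2 -e1 addKn.
rewrite (_ : (_ * _)%N = ('C(a + b + c, b) * 'C(a + c, a) * (a`! * b`! * c`!))%N).
  by rewrite mulnK // !muln_gt0 !fact_gt0.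
by rewrite -!mulnA; congr (_ * _)%N; rewrite mulnCA; congr (_ * _)%N; rewrite mulnCA.
Qed.

(** Absorption: [(q + b) C(q + b - 1, q - 1) = q C(q + b, q)]. With [n = q d] and [p = b d] it
    trades the factor [1/n] for [1/(p + n)]. *)
Lemma multinomial3_bin q a b : (0 < q)%N -> (a <= q)%N ->
  (multinomial3 a b (q - a) * q
    = (b + q) * ('C(q, a) * 'C(q + b - 1, q - 1)))%N.
Proof.
move=> q0 aq; rewrite multinomial3E addnAC subnKC //.
have := mul_bin_diag (q + b) q.-1; rewrite prednK // -!subn1 => E.
have bE : 'C(q + b, b) = 'C(q + b, q) by rewrite -bin_sub ?leq_addl // addnK.
by rewrite bE mulnAC [X in (X * _)%N]mulnC -E addnC -mulnA [X in (_ * X)%N]mulnC.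
Qed.

Theorem theorem3p2 (R : realType) (n : nat) (gT : finGroupType)
    (G : {group gT}) (gam : gT) (zeta : R[i]) (i : nat)
    (n_ge1 : (1 <= n)%N) (card_G : #|G| = n) (gam_gen : G :=: <[gam]>%g)
    (zeta_prim : n.-primitive_root zeta) (i_lt_n : (i < n)%N) :
  let dim (p m : nat) : nat :=
    \rank (isotypic (sym_ext_repr (regular_repr R[i] G) p m)
                    (cyc_char gam zeta i)) in
  let cst := @fps2_cst R[i] in
  let s := fps2_s R[i] in
  let t := fps2_t R[i] in
  let c (d : nat) : R[i] := ramanujan_sum R[i] d i in
  [/\ fps2_gf (fun p m => (dim p m)%:R)
      = cst n%:R^-1 *
        \sum_(d <- divisors n)
          cst (c d) * ((1 - (- t) ^+ d) ^+ (n %/ d) / (1 - s ^+ d) ^+ (n %/ d)),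
      cst n%:R^-1 *
        \sum_(d <- divisors n)
          cst (c d) * ((1 - (- t) ^+ d) ^+ (n %/ d) / (1 - s ^+ d) ^+ (n %/ d))
      = cst n%:R^-1 *
        \sum_(d <- divisors n)
          cst (c d)
          * (\sum_(0 <= a < (n %/ d).+1)
               (-1) ^+ (d.+1 * a) * cst 'C(n %/ d, a)%:R * t ^+ (a * d))
          * fps_sum (fun b =>
               cst 'C(n %/ d + b - 1, n %/ d - 1)%:R * s ^+ (b * d))
    & forall p m : nat, (m <= n)%N ->
      (dim p m)%:R
      = (-1) ^+ m / (p + n)%:R *
        \sum_(d <- divisors n | (d %| p)%N && (d %| m)%N)
          (-1) ^+ (m %/ d) * c d
          * (multinomial3 (m %/ d) (p %/ d) ((n - m) %/ d))%:R :> R[i] ].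
Proof.
move=> dim cst s t c.
have nF : #|G|%:R != 0 :> R[i] by rewrite card_G Num.Theory.pnatr_eq0 -lt0n.
have zG : #|G|.-primitive_root zeta by rewrite card_G.
have div_gt0 d : d \in divisors n -> (0 < d)%N /\ (0 < n %/ d)%N.
  rewrite -dvdn_divisors // => dn; have d0 := dvdn_gt0 n_ge1 dn.
  by split; rewrite ?divn_gt0 // dvdn_leq.
have gf_quotients : fps2_gf (fun p m => (dim p m)%:R) = cst n%:R^-1 *
    \sum_(d <- divisors n)
      cst (c d) * ((1 - (- t) ^+ d) ^+ (n %/ d) / (1 - s ^+ d) ^+ (n %/ d)).
  (* Generating function of the traces of [gam^k]. *)
  pose gf (k : 'I_n) : {fps2 R[i]} := fps2_gf (fun p m =>
    (\sum_(h in exponents n p) \prod_(x < n) ((zeta ^+ k) ^+ x) ^+ h x)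
    * \sum_(A : {set 'I_n} | #|A| == m) \prod_(x in A) (zeta ^+ k) ^+ x).
  transitivity (cst n%:R^-1 * \sum_(k < n) cst (zeta ^+ (i * k))^-1 * gf k).
    apply/fpsP => p; apply/fpsP => m.
    rewrite fps2_coef_cstM fps2_coef_sum [LHS](dim_sym_ext gam_gen zG nF) card_G.
    by congr (_ * _); apply: eq_bigr => k _; rewrite fps2_coef_cstM.
  (* For [zeta^k] of order [d] the quotient depends on [d] alone, so it factors out and leaves the
     Ramanujan sum. *)
  congr (_ * _); rewrite -(sum_by_primitive_order zeta_prim (f := fun d k =>
    cst (zeta ^+ (i * k))^-1 *
      ((1 - (- t) ^+ d) ^+ (n %/ d) / (1 - s ^+ d) ^+ (n %/ d)))); last first.
    by move=> d k dn kd; rewrite /gf (fps2_gf_weights kd dn).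
  rewrite big_seq [RHS]big_seq; apply: eq_bigr => d; rewrite -dvdn_divisors // => dn.
  by rewrite -mulr_suml /c (ramanujan_sumE zeta_prim) // /cst rmorph_sum.
have quotients_expand : cst n%:R^-1 *
        \sum_(d <- divisors n)
          cst (c d) * ((1 - (- t) ^+ d) ^+ (n %/ d) / (1 - s ^+ d) ^+ (n %/ d))
      = cst n%:R^-1 *
        \sum_(d <- divisors n)
          cst (c d)
          * (\sum_(0 <= a < (n %/ d).+1)
               (-1) ^+ (d.+1 * a) * cst 'C(n %/ d, a)%:R * t ^+ (a * d))
          * fps_sum (fun b =>
               cst 'C(n %/ d + b - 1, n %/ d - 1)%:R * s ^+ (b * d)).
  congr (_ * _); rewrite big_seq [RHS]big_seq; apply: eq_bigr => d /div_gt0[d0 q0].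
  rewrite -mulrA; congr (_ * (_ * _)); first exact: numerator_expand.
  exact: denominator_inv.
split=> // p m mn.
have -> : (dim p m)%:R = fps2_gf (fun p m => (dim p m)%:R : R[i]) p m by [].
rewrite gf_quotients quotients_expand fps2_coef_cstM fps2_coef_sum.
(* Both sides become sums over all divisors of [n], with zero terms unless [d] divides [p] and
   [m]. *)
rewrite [in RHS]big_mkcond !mulr_sumr big_seq [RHS]big_seq.
apply: eq_bigr => d /[dup] dn /div_gt0[d0 q0]; rewrite -mulrA fps2_coef_cstM.
rewrite coef_numerator_denominator //; case: ifP => [/andP[dp dm]|_]; last first.
  by rewrite !mulr0.
rewrite -dvdn_divisors // in dn.
move: dn dp dm => /dvdnP[q nE] /dvdnP[b ->] /dvdnP[a mE].
(* This is where [m <= n] enters: it makes [(n - m)/d] equal to [q - a]. *)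
have aq : (a <= q)%N by move: mn; rewrite nE mE leq_pmul2r.
have {}q0 : (0 < q)%N by move: q0; rewrite nE mulnK.
rewrite mE nE -mulnBl !mulnK // -mulnDl.
have := congr1 (fun x => x%:R : R[i]) (multinomial3_bin b q0 aq).
rewrite !natrM.
have qF : q%:R != 0 :> R[i] by rewrite Num.Theory.pnatr_eq0 -lt0n.
have dF : d%:R != 0 :> R[i] by rewrite Num.Theory.pnatr_eq0 -lt0n.
have bF : (b + q)%:R != 0 :> R[i].
  by rewrite Num.Theory.pnatr_eq0 addn_eq0 negb_and -!lt0n q0 orbT.
move=> mult.
have -> : 'C(q, a)%:R * 'C(q + b - 1, q - 1)%:R
    = (multinomial3 a b (q - a))%:R * q%:R / (b + q)%:R :> R[i].
  by rewrite mult mulrAC mulfV // mul1r.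
(* The sign splits as [(-1)^m (-1)^(m/d)], since [m = a d]. *)
have -> : (-1) ^+ (d.+1 * a) = (-1) ^+ (a * d) * (-1) ^+ a :> R[i].
  by rewrite mulSn addnC mulnC exprD.
move: (c d) ((-1) ^+ _) ((-1) ^+ a) (multinomial3 _ _ _)%:R => x y z u.
move: q%:R d%:R (b + q)%:R qF dF bF => q' d' r' qF dF bF.
by field; rewrite qF dF bF.
Qed.
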